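(* Let $(M,d)$ be the countable metric space defined in the context. Let $K$ be a compact Hausdorff space and $X=C(K)$. If $(M,d)$ embeds bi-Lipschitz into $X$ with distortion strictly less than $2$, then $X$ is isometrically universal for all separable Banach spaces, i.e. every separable Banach space is linearly isometric to a subspace of $X$.
   Context: $\mathbb N=\{1,2,3,\dots\}$. The metric space $(M,d)$: let $F=\{A\subset\mathbb N: 1\le |A|<\infty\}$ be the set of all finite nonempty subsets of $\mathbb N$, and let $M=\{\emptyset\}\cup\mathbb N\cup F$ (the three pieces are regarded as pairwise disjoint). Make $M$ into a graph by putting an edge between $\emptyset$ and every $n\in\mathbb N$, and an edge between $n\in\mathbb N$ and $A\in F$ exactly when $n\in A$; there are no other edges. The metric $d$ is the shortest path metric of this graph. Explicitly, for $n\ne m$ in $\mathbb N$ and $A\neq B$ in $F$: $d(\emptyset,n)=1$; $d(n,m)=2$; $d(n,A)=1$ if $n\in A$ and $d(n,A)=3$ if $n\notin A$; $d(\emptyset,A)=2$; $d(A,B)=2$ if $A\cap B\ne\emptyset$ and $d(A,B)=4$ if $A\cap B=\emptyset$. A map $f:(M,d)\to(N,\rho)$ between metric spaces is bi-Lipschitz if there are constants $C_1,C_2>0$ with $C_1d(x,y)\le\rho(f(x),f(y))\le C_2d(x,y)$ for all $x,y\in M$; its distortion $\mathrm{dist}(f)$ is the infimum of $C_2/C_1$ over all such pairs of constants. $M$ embeds bi-Lipschitz into $N$ with distortion $D$ if there is a bi-Lipschitz $f:M\to N$ with $\mathrm{dist}(f)=D$. $C(K)$ is the Banach space of continuous scalar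 functions on $K$ with the supremum norm (the separable Banach spaces are over the same scalar field). *)

(* Defs.v *)
From HB Require Import structures.
From mathcomp Require Import all_boot all_order all_algebra finmap.
From mathcomp Require Import all_classical all_reals all_analysis.
From mathcomp Require Import complex.

Set Implicit Arguments.
Unset Strict Implicit.
Unset Printing Implicit Defensive.

Import Order.TTheory GRing.Theory Num.Theory.
Import numFieldNormedType.Exports.

Local Open Scope classical_set_scope.
Local Open Scope ring_scope.

Definition posnat := {n : nat | (0 < n)%N}.

Definition finsub := {A : {fset posnat} | A != fset0}.

Inductive vertex := Root | Pt of posnat | Fin of finsub.

Definition edge (x y : vertex) : bool :=
  match x, y with
  | Root, Pt _ | Pt _, Root => true
  | Pt n, Fin A | Fin A, Pt n => n \in val A
  | _, _ => false
  end.

Definition walk (x y : vertex) (n : nat) : bool :=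
  `[< exists p : seq vertex, [/\ path edge x p, last x p = y & size p = n] >].

Lemma walkP x y n : reflect
  (exists p : seq vertex, [/\ path edge x p, last x p = y & size p = n])
  (walk x y n).
Proof. exact: asboolP. Qed.

Lemma finsub_mem (A : finsub) : exists n, n \in val A.
Proof. by case: A => A /= /fset0Pn. Qed.

Lemma edge_sym x y : edge x y = edge y x.
Proof. by case: x y => [|n|A] [|m|B]. Qed.

Lemma walk_cat x y z m n : walk x y m -> walk y z n -> walk x z (m + n).
Proof.
move=> /walkP[p [px py <-]] /walkP[q [qy qz <-]]; apply/walkP; exists (p ++ q).
by rewrite cat_path last_cat size_cat py px qy qz.
Qed.

Lemma walk0 x : walk x x 0.
Proof. by apply/walkP; exists [::]. Qed.

Lemma walk1 x y : edge x y -> walk x y 1.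
Proof. by move=> xy; apply/walkP; exists [:: y]; rewrite /= xy. Qed.

Lemma walk_root x : exists n, walk x Root n.
Proof.
case: x => [|n|A]; first by exists 0%N; exact: walk0.
- by exists 1%N; exact: walk1.
- have [n nA] := finsub_mem A.
  by exists 2%N; apply: (@walk_cat _ (Pt n) _ 1 1); exact: walk1.
Qed.

Lemma walk_sym x y n : walk x y n -> walk y x n.
Proof.
move=> /walkP[p [px <- <-]]; elim: p x px => [|z p IH] x /=.
  by move=> _; exact: walk0.
move=> /andP[xz zp]; rewrite -addn1; apply: walk_cat (IH _ zp) _.
by apply: walk1; rewrite edge_sym.
Qed.

Lemma walk_connected x y : exists n, walk x y n.
Proof.
have [m xm] := walk_root x; have [n /walk_sym yn] := walk_root y.
by exists (m + n)%N; exact: walk_cat xm yn.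
Qed.

Definition path_dist (x y : vertex) : nat := ex_minn (walk_connected x y).

Lemma path_distP x y n : walk x y n ->
  (forall m, walk x y m -> (n <= m)%N) -> path_dist x y = n.
Proof.
move=> xyn min; rewrite /path_dist; case: ex_minnP => m xym mmin.
by apply/eqP; rewrite eqn_leq mmin// min.
Qed.

Lemma walk0E x y : walk x y 0 -> x = y.
Proof. by move=> /walkP[[|z p] [] //]. Qed.

Lemma walkSE x y n : walk x y n.+1 -> exists2 z, edge x z & walk z y n.
Proof.
move=> /walkP[[|z p] [] //= /andP[xz zp] py [pn]].
by exists z => //; apply/walkP; exists p.
Qed.

(* The graph is bipartite, with [is_pt] as bipartition. *)
Definition is_pt (x : vertex) : bool := if x is Pt _ then true else false.

Lemma walk_parity x y n : walk x y n -> odd n = is_pt x (+) is_pt y.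
Proof.
move=> /walkP[p [px <- <-]]; elim: p x px => [|z p IH] x /=; first by rewrite addbb.
by move=> /andP[xz /IH ->]; case: x z xz => [|?|?] [|?|?] //=; rewrite ?negbK.
Qed.

Lemma path_distxx x : path_dist x x = 0%N.
Proof. by apply: path_distP => //; exact: walk0. Qed.

Lemma path_dist_sym x y : path_dist x y = path_dist y x.
Proof.
rewrite {1}/path_dist; case: ex_minnP => n xyn min; apply/esym/path_distP.
  exact: walk_sym.
by move=> m /walk_sym/min.
Qed.

Lemma path_dist_triangle y x z :
  (path_dist x z <= path_dist x y + path_dist y z)%N.
Proof.
rewrite /path_dist; case: ex_minnP => n _ min; case: ex_minnP => m xm _.
by case: ex_minnP => k yk _; exact/min/(walk_cat xm yk).
Qed.

Lemma path_dist_root_pt n : path_dist Root (Pt n) = 1%N.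
Proof.
apply: path_distP => [|[/walk0E|]//]; exact: walk1.
Qed.

Lemma path_dist_pt_pt n m : n != m -> path_dist (Pt n) (Pt m) = 2%N.
Proof.
move=> /eqP nm; apply: path_distP.
  by apply: (@walk_cat _ Root _ 1 1); exact: walk1.
by move=> [/walk0E[/nm]//|[/walk_parity//|]].
Qed.

Lemma path_dist_root_fin A : path_dist Root (Fin A) = 2%N.
Proof.
apply: path_distP; last by move=> [/walk0E//|[/walk_parity//|]].
have [n nA] := finsub_mem A.
by apply: (@walk_cat _ (Pt n) _ 1 1); exact: walk1.
Qed.

Lemma path_dist_pt_fin n (A : finsub) :
  path_dist (Pt n) (Fin A) = if n \in val A then 1%N else 3%N.
Proof.
case: ifPn => nA; apply: path_distP.
- exact: walk1.
- by move=> [/walk0E|].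
- have [m mA] := finsub_mem A; apply: (@walk_cat _ Root _ 1 2); first exact: walk1.
  by apply: (@walk_cat _ (Pt m) _ 1 1); exact: walk1.
- move=> [/walk0E//|[|[/walk_parity//|//]]].
  by move=> /walkSE[z + /walk0E zA]; rewrite zA /= (negPf nA).
Qed.

Lemma path_dist_fin_fin (A B : finsub) : A != B ->
  path_dist (Fin A) (Fin B) =
    if (val A `&` val B)%fset != fset0 then 2%N else 4%N.
Proof.
move=> /eqP AB; case: ifPn => [/fset0Pn[n]|/negPn/eqP AB0].
  rewrite inE => /andP[nA nB]; apply: path_distP.
    by apply: (@walk_cat _ (Pt n) _ 1 1); exact: walk1.
  by move=> [/walk0E[/AB]//|[/walk_parity//|]].
apply: path_distP.
  have [n nA] := finsub_mem A; have [m mB] := finsub_mem B.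
  apply: (@walk_cat _ Root _ 2 2).
    by apply: (@walk_cat _ (Pt n) _ 1 1); exact: walk1.
  by apply: (@walk_cat _ (Pt m) _ 1 1); exact: walk1.
move=> [/walk0E[/AB]//|[/walk_parity//|[|[/walk_parity//|//]]]].
move=> /walkSE[[|n|C]//= nA /walkSE[z + /walk0E zB]].
rewrite zB /= => nB.
have : n \in (val A `&` val B)%fset by rewrite inE nA nB.
by rewrite AB0 inE.
Qed.

Section distortion.
Context {R : realType} (M N : Type) (d : M -> M -> R) (rho : N -> N -> R).

Definition bilipschitz_consts (f : M -> N) (C1 C2 : R) : Prop :=
  [/\ 0 < C1, 0 < C2 &
    forall x y, C1 * d x y <= rho (f x) (f y) <= C2 * d x y].

Definition bilipschitz (f : M -> N) : Prop :=
  exists C1 C2, bilipschitz_consts f C1 C2.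

Definition distortion (f : M -> N) : R :=
  inf [set r | exists C1 C2, bilipschitz_consts f C1 C2 /\ r = C2 / C1].

Definition embeds_with_distortion (D : R) : Prop :=
  exists f, bilipschitz f /\ distortion f = D.

End distortion.

Inductive scalar_kind := RealScalars | ComplexScalars.

Section scalars.
Context (R : realType).

Definition scalar_field (s : scalar_kind) : numFieldType :=
  match s with
  | RealScalars => R
  | ComplexScalars => R[i]
  end.

Definition of_real (s : scalar_kind) : R -> scalar_field s :=
  match s return R -> scalar_field s with
  | RealScalars => id
  | ComplexScalars => real_complex R
  end.

(* The norm of a space over [scalar_field s] takes its values in
   [scalar_field s]; [modulus] brings them back to [R]. *)
Definition modulus (s : scalar_kind) : scalar_field s -> R :=
  match s return scalar_field s -> R with
  | RealScalars => fun z => `|z|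
  | ComplexScalars => fun z => Normc.normc z
  end.

End scalars.

Arguments of_real {R s}.
Arguments modulus {R s}.

Section scalar_theory.
Context {R : realType} {s : scalar_kind}.
Implicit Types (z w : scalar_field R s) (a b : R).

Lemma of_real_modulus z : of_real (modulus z) = `|z|.
Proof. by case: s z. Qed.

Lemma of_realK a : 0 <= a -> modulus (of_real a : scalar_field R s) = a.
Proof.
case: s => a0 /=; first by rewrite ger0_norm.
by rewrite expr0n addr0 sqrtr_sqr ger0_norm.
Qed.

Lemma ler_of_real a b : ((of_real a : scalar_field R s) <= of_real b) = (a <= b).
Proof. by case: s => //=; rewrite lecR. Qed.

Lemma of_realD a b : of_real (a + b) = of_real a + of_real b :> scalar_field R s.
Proof. by case: s => //=; rewrite rmorphD. Qed.

Lemma of_realM a b : of_real (a * b) = of_real a * of_real b :> scalar_field R s.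
Proof. by case: s => //=; rewrite rmorphM. Qed.

Lemma of_real0 : of_real 0 = 0 :> scalar_field R s.
Proof. by case: s. Qed.

Lemma of_real_inj : injective (of_real : R -> scalar_field R s).
Proof. by case: s => //= a b []. Qed.

Lemma modulus_ge0 z : 0 <= modulus z.
Proof. by rewrite -ler_of_real of_real_modulus of_real0. Qed.

Lemma ler_modulusD z w : modulus (z + w) <= modulus z + modulus w.
Proof. by rewrite -ler_of_real of_realD !of_real_modulus ler_normD. Qed.

Lemma modulusM z w : modulus (z * w) = modulus z * modulus w.
Proof. by apply: of_real_inj; rewrite of_realM !of_real_modulus normrM. Qed.

Lemma modulus_eq0 z : modulus z = 0 -> z = 0.
Proof.
by move=> z0; apply/normr0_eq0; rewrite -of_real_modulus z0 of_real0.
Qed.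

Lemma modulus0 : modulus (0 : scalar_field R s) = 0.
Proof. by apply: of_real_inj; rewrite of_real_modulus normr0 of_real0. Qed.

Lemma continuous_modulus : continuous (modulus : scalar_field R s -> R).
Proof.
move=> z; have FF : Filter (nbhs z) by exact: nbhs_filter.
apply/(@cvgrPdist_lt _ _ _ _ FF) => e e0.
have E0 : 0 < (of_real e : scalar_field R s).
  by rewrite lt_def -{1 2}of_real0 ler_of_real ltW// andbT (inj_eq of_real_inj) gt_eqF.
have : \forall w \near z, `|z - w| < (of_real e : scalar_field R s).
  by apply/nbhs_normP; exists (of_real e).
apply: filterS => w zw.
have {}zw : modulus (z - w) < e.
  move: zw; rewrite -of_real_modulus !lt_def (inj_eq of_real_inj).
  by rewrite ler_of_real.
apply: le_lt_trans zw; rewrite ler_norml; apply/andP; split.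
  rewrite lerNl opprB lerBlDr.
  have -> : modulus (z - w) = modulus (w - z).
    by apply: of_real_inj; rewrite !of_real_modulus distrC.
  by rewrite (le_trans _ (ler_modulusD _ _))// subrK.
by rewrite lerBlDr (le_trans _ (ler_modulusD _ _))// subrK.
Qed.

End scalar_theory.

(* C(K). Compactness of K is not built into the carrier, but is needed to norm
   it, so the carrier takes a proof of it as an argument. *)
Definition contfun (R : realType) (s : scalar_kind) (K : topologicalType)
  (cK : compact [set: K]) := continuousType K (scalar_field R s).

Section contfun.
Context (R : realType) (s : scalar_kind) (K : topologicalType).
Context (cK : compact [set: K]).
Local Notation F := (scalar_field R s).
Local Notation CK := (contfun R s cK).

HB.instance Definition _ := Choice.on CK.

Let cadd_cts (f g : CK) : continuous (fun x => f x + g x : F).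
Proof. by move=> x; apply: cvgD; exact: cts_fun. Qed.

Let copp_cts (f : CK) : continuous (fun x => - f x : F).
Proof. by move=> x; apply: cvgN; exact: cts_fun. Qed.

Let cscale_cts (a : F) (f : CK) : continuous (fun x => a * f x : F).
Proof. by move=> x; apply: cvgM; [exact: cvg_cst|exact: cts_fun]. Qed.

Let czero_cts : continuous (fun _ : K => 0 : F).
Proof. by move=> x; exact: cvg_cst. Qed.

Definition contfun_zero : CK := mkcts czero_cts.
Definition contfun_add (f g : CK) : CK := mkcts (@cadd_cts f g).
Definition contfun_opp (f : CK) : CK := mkcts (@copp_cts f).
Definition contfun_scale (a : F) (f : CK) : CK := mkcts (@cscale_cts a f).

Let addA : associative contfun_add.
Proof. by move=> f g h; apply/continuousEP => x /=; rewrite /mkcts addrA. Qed.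

Let addC : commutative contfun_add.
Proof. by move=> f g; apply/continuousEP => x /=; rewrite /mkcts addrC. Qed.

Let add0 : left_id contfun_zero contfun_add.
Proof. by move=> f; apply/continuousEP => x /=; rewrite /mkcts add0r. Qed.

Let addN : left_inverse contfun_zero contfun_opp contfun_add.
Proof. by move=> f; apply/continuousEP => x /=; rewrite /mkcts addNr. Qed.

HB.instance Definition _ := GRing.isZmodule.Build CK addA addC add0 addN.

Let scaleA a b f : contfun_scale a (contfun_scale b f) = contfun_scale (a * b) f.
Proof. by apply/continuousEP => x /=; rewrite /mkcts mulrA. Qed.

Let scale1 : left_id 1 contfun_scale.
Proof. by move=> f; apply/continuousEP => x /=; rewrite /mkcts mul1r. Qed.

Let scaleDr : right_distributive contfun_scale +%R.
Proof. by move=> a f g; apply/continuousEP => x /=; rewrite /mkcts mulrDr. Qed.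

Let scaleDl f : {morph contfun_scale^~ f : a b / a + b}.
Proof. by move=> a b; apply/continuousEP => x /=; rewrite /mkcts mulrDl. Qed.

HB.instance Definition _ :=
  GRing.Zmodule_isLmodule.Build F CK scaleA scale1 scaleDr scaleDl.

(* On the empty space this is [sup set0 = 0]. *)
Definition sup_norm (f : CK) : R := sup [set modulus (f x) | x in [set: K]].

Lemma contfun_has_ubound (f : CK) :
  has_ubound [set modulus (f x) | x in [set: K]].
Proof.
have [->|/set0P K0] := eqVneq [set: K] set0.
  by rewrite image_set0; exists 0 => ? [].
have mf : {within [set: K], continuous (modulus \o f)}.
  apply: continuous_subspaceT => x; apply: continuous_comp.
    exact: cts_fun.
  exact: continuous_modulus.
have [c _ cmax] := compact_EVT_max K0 cK mf.
by exists (modulus (f c)) => _ [x _ <-]; apply: cmax; rewrite inE.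
Qed.

Lemma sup_norm_ub (f : CK) x : modulus (f x) <= sup_norm f.
Proof. by apply: ub_le_sup; [exact: contfun_has_ubound|exists x]. Qed.

Lemma sup_norm_le (f : CK) a :
  0 <= a -> (forall x, modulus (f x) <= a) -> sup_norm f <= a.
Proof.
move=> a0 fa; have [K0|/set0P[x _]] := eqVneq [set: K] set0.
  by rewrite /sup_norm K0 image_set0 sup0.
by apply: ge_sup; [exists (modulus (f x)), x|move=> _ [y _ <-]].
Qed.

Lemma sup_norm_ge0 (f : CK) : 0 <= sup_norm f.
Proof.
have [K0|/set0P[x _]] := eqVneq [set: K] set0.
  by rewrite /sup_norm K0 image_set0 sup0.
exact: le_trans (modulus_ge0 _) (sup_norm_ub f x).
Qed.

Let normD (f g : CK) :
  (of_real (sup_norm (f + g)) : F) <= of_real (sup_norm f) + of_real (sup_norm g).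
Proof.
rewrite -of_realD ler_of_real; apply: sup_norm_le => [|x].
  by rewrite addr_ge0// sup_norm_ge0.
by rewrite (le_trans (ler_modulusD _ _))// lerD// sup_norm_ub.
Qed.

Let norm0 (f : CK) : of_real (sup_norm f) = 0 :> F -> f = 0.
Proof.
rewrite -of_real0 => /of_real_inj f0; apply/continuousEP => x.
apply: modulus_eq0; apply/eqP; rewrite eq_le modulus_ge0 andbT -f0.
exact: sup_norm_ub.
Qed.

Let sup_normZ_le (a : F) (f : CK) : sup_norm (a *: f) <= modulus a * sup_norm f.
Proof.
apply: sup_norm_le => [|x]; first by rewrite mulr_ge0 ?modulus_ge0 ?sup_norm_ge0.
by rewrite [leLHS]modulusM ler_wpM2l ?modulus_ge0 ?sup_norm_ub.
Qed.

Let normZ (a : F) (f : CK) :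
  of_real (sup_norm (a *: f)) = `|a| * of_real (sup_norm f) :> F.
Proof.
rewrite -of_real_modulus -of_realM; congr of_real; apply/eqP.
rewrite eq_le sup_normZ_le /=; have [->|a0] := eqVneq a 0.
  by rewrite modulus0 mul0r sup_norm_ge0.
have aV : modulus a * modulus a^-1 = 1.
  by rewrite -modulusM mulfV//; apply: (@of_real_inj R s); rewrite of_real_modulus normr1; case: s.
rewrite -{1}[f](scalerK a0) (le_trans (ler_wpM2l (modulus_ge0 _) (sup_normZ_le _ _)))//.
by rewrite mulrA aV mul1r.
Qed.

HB.instance Definition _ := Lmodule_isNormed.Build F CK normD normZ norm0.

Lemma contfun_normE (f : CK) : `|f| = of_real (sup_norm f) :> F.
Proof. by []. Qed.

End contfun.

Definition norm_dist (R : realType) (s : scalar_kind)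
  (X : normedModType (scalar_field R s)) (x y : X) : R := modulus `|x - y|.

Definition separable (T : topologicalType) : Prop :=
  exists S : set T, countable S /\ dense S.

Definition isometrically_universal (R : realType) (s : scalar_kind)
    (X : normedModType (scalar_field R s)) : Prop :=
  forall E : completeNormedModType (scalar_field R s), separable E ->
    exists T : {linear E -> X}, forall x : E, `|T x| = `|x|.

(* Main.v *)
Require Import Defs.
From HB Require Import structures.
From mathcomp Require Import finmap.
From mathcomp Require Import all_boot all_order all_algebra.
From mathcomp Require Import all_classical all_reals all_analysis.
From mathcomp Require Import ring lra.
From mathcomp Require complex.
Import Order.TTheory GRing.Theory Num.Theory.
Import numFieldNormedType.Exports.
Local Open Scope classical_set_scope.
Local Open Scope ring_scope.

(* If phi_n is the image of the point n, then for disjoint finite sets A and B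
   the images of A and B are at distance at least 4 C1, so at some t in K all
   phi_a(t), a in A, are separated from all phi_b(t), b in B, by the positive
   amount 2 C1 - C2. By compactness and the pigeonhole principle the map
   t |-> (|phi_n(t) - phi_m(t)|)_(n,m) must have uncountable range. A closed set
   with uncountable image contains two such sets separated by one of the real
   functions; iterating, one gets continuous functions h_s : K -> [0, 1] indexed
   by the nodes of the binary tree such that every finite branch s is realised by
   a point of K at which each h along s takes the prescribed value 0 or 1.

   For a separable E, the unit ball of the real dual is encoded by the branches
   of the same tree, with a functional u_s attached to each node s. At t in K the
   functions h_s are the transition probabilities of a random walk down the tree;
   the averages of u_s(x) over level n converge uniformly in t, and the limit
   U(x) is a linear isometric copy of E (as a real space) in C(K): norms are
   attained up to epsilon thanks to Hahn-Banach. The complex case follows by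
   x |-> U(x) - i U(i x). *)

Set Implicit Arguments.
Unset Strict Implicit.
Unset Printing Implicit Defensive.

(** * Hahn-Banach via minimal sublinear functionals *)

Definition sublinear {R : realType} {V : lmodType R} (q : V -> R) : Prop :=
  (forall x y, q (x + y) <= q x + q y) /\
  (forall (a : R) x, 0 <= a -> q (a *: x) <= a * q x).

Definition reallinear {R : realType} {V : lmodType R} (u : V -> R) : Prop :=
  forall (a : R) x y, u (a *: x + y) = a * u x + u y.

Section hahn_banach.
Context {R : realType} {V : lmodType R}.
Implicit Types (p q : V -> R) (x y z : V) (a b t : R).

Lemma sublinear0 q : sublinear q -> q 0 = 0.
Proof.
move=> [qD qZ]; apply/eqP; rewrite eq_le.
have := qZ 0 0 (lexx _); rewrite scale0r mul0r => -> /=.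
by have := qD 0 0; rewrite addr0 -[leLHS]add0r lerD2r.
Qed.

Lemma sublinear_ge0 q x : sublinear q -> 0 <= q x + q (- x).
Proof. by move=> qs; rewrite -(sublinear0 qs) -(subrr x); apply: qs.1. Qed.

Lemma sublinearZ q a x : sublinear q -> 0 <= a -> q (a *: x) = a * q x.
Proof.
move=> qs; rewrite le_eqVlt => /predU1P[<-|a0].
  by rewrite scale0r mul0r sublinear0.
apply: le_anti; apply/andP; split; first exact/qs.2/ltW.
rewrite -ler_pdivlMl//.
rewrite -{1}[x](scalerK (lt0r_neq0 a0)); apply: qs.2.
by rewrite invr_ge0 ltW.
Qed.

(** A sublinear minorant of [q] whose value at [- x] is at most [- q x]; it lowers [q] strictly
    unless [q] is already odd along [x]. *)
Definition steepen q x y : R :=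
  inf [set q (y + t *: x) - t * q x | t in [set t : R | 0 <= t]].

Lemma steepen_has_inf q x y : sublinear q ->
  has_inf [set q (y + t *: x) - t * q x | t in [set t : R | 0 <= t]].
Proof.
move=> qs; split; first by exists (q (y + 0 *: x) - 0 * q x), 0 => /=.
exists (- q (- y)) => _ [t /= t0 <-].
have := qs.1 (y + t *: x) (- y); rewrite addrAC subrr add0r sublinearZ//; lra.
Qed.

Lemma steepen_le q x y t : sublinear q -> 0 <= t ->
  steepen q x y <= q (y + t *: x) - t * q x.
Proof.
by move=> /(steepen_has_inf x y)[_ qi] t0; apply: ge_inf => //; exists t.
Qed.

Lemma steepen_le_self q x y : sublinear q -> steepen q x y <= q y.
Proof.
by move=> qs; have := steepen_le x y qs (lexx _); rewrite scale0r addr0 mul0r subr0.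
Qed.

Lemma steepenN q x : sublinear q -> steepen q x (- x) <= - q x.
Proof.
move=> qs; have := steepen_le x (- x) qs ler01.
by rewrite scale1r addNr sublinear0// mul1r add0r.
Qed.

Lemma steepen_sublinear q x : sublinear q -> sublinear (steepen q x).
Proof.
move=> qs; split=> [y z|a y]; last first.
  rewrite le_eqVlt => /predU1P[<-|a0].
    by rewrite scale0r mul0r -[leRHS](sublinear0 qs) steepen_le_self.
  rewrite -ler_pdivrMl//; apply: lb_le_inf.
    by have [] := steepen_has_inf x y qs.
  move=> _ [t /= t0 <-].
  rewrite ler_pdivrMl// mulrBr mulrA -(sublinearZ (y + t *: x) qs (ltW a0)).
  rewrite scalerDr scalerA.
  by apply: steepen_le => //; rewrite mulr_ge0// ltW.
rewrite -lerBlDr; apply: lb_le_inf; first by have [] := steepen_has_inf x y qs.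
move=> _ [t /= t0 <-]; rewrite lerBlDr -lerBlDl.
apply: lb_le_inf; first by have [] := steepen_has_inf x z qs.
move=> _ [r /= r0 <-].
have := steepen_le x (y + z) qs (addr_ge0 t0 r0).
have := qs.1 (y + t *: x) (z + r *: x).
by rewrite addrACA -scalerDl; lra.
Qed.

(** Zorn's lemma for the reversed pointwise order. A nonempty chain is bounded by its pointwise
    infimum, which is finite because [q <= p] forces [q x >= - p (- x)], and subadditive because any
    two members of the chain are comparable. *)
Lemma minimal_sublinear p : sublinear p ->
  exists q, [/\ sublinear q, forall x, q x <= p x &
    forall q', sublinear q' -> (forall x, q' x <= q x) -> q' = q].
Proof.
move=> ps.
pose T := {q : V -> R | sublinear q /\ forall x, q x <= p x}.
pose below (q r : T) : bool := `[< forall x, sval r x <= sval q x >].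
have [| | |A Atot|[q [qs qp]] qmin] := @Zorn T below.
- by move=> q; apply/asboolP.
- by move=> q r s /asboolP qr /asboolP rs; apply/asboolP => x; exact: le_trans (qr x).
- move=> [q q'] [r r'] /asboolP /= qr /asboolP /= rq; apply: eq_exist => /=.
  by apply/funext => x; apply: le_anti; rewrite qr rq.
- have [->|/set0P[q0 Aq0]] := eqVneq A set0.
    by exists (exist _ p (conj ps (fun x => lexx _))).
  pose i x := inf [set sval q x | q in A].
  have hi x : has_inf [set sval q x | q in A].
    split; first by exists (sval q0 x), q0.
    exists (- p (- x)) => _ [[q [qs qp]] Aq <-] /=.
    have := sublinear_ge0 x qs; have := qp (- x); lra.
  have ile (q : T) x : A q -> i x <= sval q x.
    by move=> Aq; apply: ge_inf; [case: (hi x)|exists q].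
  have is_ : sublinear i.
    split=> [x y|a x a0].
      rewrite -lerBlDr; apply: lb_le_inf; first by case: (hi x).
      move=> _ [q Aq <-]; rewrite lerBlDr -lerBlDl.
      apply: lb_le_inf; first by case: (hi y).
      move=> _ [r Ar <-]; rewrite lerBlDl.
      have [/asboolP qr|/asboolP rq] := Atot _ _ Aq Ar.
        apply: (le_trans (ile r _ Ar)); have := (svalP r).1.1 x y.
        have := qr x; lra.
      apply: (le_trans (ile q _ Aq)); have := (svalP q).1.1 x y.
      have := rq y; lra.
    move: a0; rewrite le_eqVlt => /predU1P[<-|a0].
      rewrite scale0r mul0r (le_trans (ile q0 _ Aq0))//.
      by rewrite sublinear0//; exact: (svalP q0).1.
    rewrite -ler_pdivrMl//; apply: lb_le_inf; first by case: (hi x).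
    move=> _ [q Aq <-]; rewrite ler_pdivrMl// -(sublinearZ x (svalP q).1 (ltW a0)).
    exact: ile.
  have ip x : i x <= p x by rewrite (le_trans (ile q0 _ Aq0))//; exact: (svalP q0).2.
  exists (exist _ i (conj is_ ip)) => q Aq; apply/asboolP => x; exact: ile.
exists q; split=> // q' q's q'q.
have q'p x : q' x <= p x by exact: le_trans (qp x).
have /(_ _)/(congr1 sval)/= := qmin (exist _ q' (conj q's q'p)).
by apply; apply/asboolP.
Qed.

Lemma minimal_sublinearN q x : sublinear q ->
  (forall q', sublinear q' -> (forall x, q' x <= q x) -> q' = q) ->
  q (- x) = - q x.
Proof.
move=> qs /(_ _ (steepen_sublinear x qs))/(_ (fun y => steepen_le_self x y qs)) qE.
apply: le_anti; rewrite -{1}qE steepenN//=.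
by have := sublinear_ge0 x qs; lra.
Qed.

(** Minimality makes [u] odd, and an odd sublinear functional is linear. Minimising below
    [steepen p x] instead of [p] forces [u (- x) <= - p x], hence [u x = p x]. *)
Lemma hahn_banach p x : sublinear p ->
  exists u : V -> R, [/\ reallinear u, forall y, u y <= p y & u x = p x].
Proof.
move=> ps; have [u [us up umin]] := minimal_sublinear (steepen_sublinear x ps).
have uN y : u (- y) = - u y by exact: minimal_sublinearN.
have ulep y : u y <= p y by exact: le_trans (steepen_le_self _ _ ps).
have uD y z : u (y + z) = u y + u z.
  apply: le_anti; rewrite us.1/=.
  by have := us.1 (y + z) (- z); rewrite addrK uN lerBrDr.
exists u; split=> // [a y z|].
  rewrite uD; congr (_ + _); have [a0|/ltW a0] := leP 0 a; first exact: sublinearZ.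
  by rewrite -[a]opprK scaleNr uN sublinearZ ?oppr_ge0// -mulNr.
apply: le_anti; rewrite ulep/=.
have := up (- x); have := steepenN x ps; rewrite uN; lra.
Qed.

End hahn_banach.

(** * Dyadic trees of functions and averages along them *)

Section splitting.
Context {R : realType} {T : Type} {I : countType} (g : I -> T -> R).

Definition large (C : set T) : Prop := ~ countable ((fun t => g^~ t) @` C).

Lemma large_nonempty C : large C -> C !=set0.
Proof.
by move=> lC; apply/set0P/eqP => C0; apply: lC; rewrite C0 image_set0.
Qed.

(** Otherwise let [D] be the union of the countably many pieces of [C] with rational threshold and
    countable image. All points of [C] outside [D] have the same image, so the image of [C] is
    countable. *)
Lemma large_split C : large C -> exists i a b, [/\ a < b,
  large (C `&` [set t | g i t <= a]) & large (C `&` [set t | b <= g i t])].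
Proof.
move=> lC; apply: contrapT => nosplit; apply: lC.
pose piece (x : I * rat * bool) := C `&`
  (if x.2 then [set t | ratr x.1.2 <= g x.1.1 t]
   else [set t | g x.1.1 t <= ratr x.1.2]).
pose D := \bigcup_(x in [set x | ~ large (piece x)]) piece x.
have cD : countable ((fun t => g^~ t) @` D).
  rewrite image_bigcup; apply: bigcup_countable => [|x /= /contrapT//].
  exact: countableP.
(* Two rationals between different values cut off two pieces; they cannot both be large, so [t] or
   [t'] lies in [D]. *)
have sep t t' i : C t -> C t' -> ~ D t -> ~ D t' -> ~ g i t < g i t'.
  move=> Ct Ct' nDt nDt' tt'.
  have [a] := rat_in_itvoo tt'; rewrite in_itv => /andP[ta at'].
  have [b] := rat_in_itvoo at'; rewrite in_itv => /andP[ab bt'].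
  apply: nosplit; exists i, (ratr a), (ratr b); split=> //.
  - by move=> sm; apply: nDt; exists (i, a, false) => [//|]; split=> //; exact: ltW.
  - by move=> sm; apply: nDt'; exists (i, b, true) => [//|]; split=> //; exact: ltW.
have [CD|/nonsubset[t0 [Ct0 nDt0]]] := pselect (C `<=` D).
  by apply: sub_countable cD; apply/subset_card_le/image_subset.
have ceq t : C t -> ~ D t -> g^~ t = g^~ t0.
  move=> Ct nDt; apply/funext => i; apply: le_anti; rewrite !leNgt.
  by apply/andP; split; apply/negP; apply: sep.
apply: (@sub_countable _ _ _
    (\bigcup_b if b then (fun t => g^~ t) @` D else [set g^~ t0])).
  apply: subset_card_le => _ [t Ct <-].
  have [Dt|nDt] := pselect (D t); first by exists true => //; exists t.
  by exists false => //=; rewrite (ceq t).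
apply: bigcup_countable => [|[] _ //]; exact: countableP.
Qed.

End splitting.

(* Nodes of the binary tree are bit sequences with the most recent bit first. *)
Fixpoint follows {R : realType} {T : Type} (h : seq bool -> T -> R)
    (s : seq bool) (t : T) : Prop :=
  if s is b :: r then h r t = b%:R /\ follows h r t else True.

Lemma large_dyadic {R : realType} {K : topologicalType} {I : countType}
    (g : I -> K -> R) :
  (forall i, continuous (g i)) -> large g [set: K] ->
  exists h : seq bool -> K -> R, [/\ forall s, continuous (h s),
    forall s t, 0 <= h s t <= 1 & forall s, exists t, follows h s t].
Proof.
move=> gc lK.
have /choice[cut cutP] (C : set K) : exists c : I * R * R,
    large g C -> [/\ c.1.2 < c.2,
      large g (C `&` [set t | g c.1.1 t <= c.1.2]) &
      large g (C `&` [set t | c.2 <= g c.1.1 t])].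
  have [/large_split[i [a [b H]]]|nC] := pselect (large g C).
    by exists (i, a, b).
  (* Sets that are not large get a default cut; its index comes from splitting all of [K]. *)
  by have [i _] := large_split lK; exists (i, 0, 0).
pose node := fix node (s : seq bool) : set K :=
  if s is b :: r then node r `&`
    (if b then [set t | (cut (node r)).2 <= g (cut (node r)).1.1 t]
     else [set t | g (cut (node r)).1.1 t <= (cut (node r)).1.2])
  else setT.
have lnode s : large g (node s).
  by elim: s => //= b s /cutP[_ l0 l1]; case: b.
(* Rescaling and clamping [g i] gives 0 on the lower piece and 1 on the upper one, so every point of
   [node s] follows [s]. *)
pose h s t := let: (i, a, b) := cut (node s) in
  Num.min 1 (Num.max 0 ((g i t - a) / (b - a))).
exists h; split.
- move=> s; rewrite /h; case: (cut (node s)) => [[i a] b] t.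
  apply: (@continuous_min R K (fun=> 1)); first exact: cvg_cst.
  apply: (@continuous_max R K (fun=> 0)); first exact: cvg_cst.
  apply: cvgM; last exact: cvg_cst.
  by apply: cvgB; [exact: gc|exact: cvg_cst].
- move=> s t; rewrite /h; case: (cut (node s)) => [[i a] b].
  by rewrite le_min ler01 le_max lexx/= ge_min lexx.
move=> s; have [t nt] := large_nonempty (lnode s); exists t.
elim: s nt => //= b s IH [ns st]; split; last exact: IH.
have := cutP _ (lnode s); rewrite /h; move: st.
case: (cut (node s)) => [[i a] c] /= + [ac _ _].
case: b => /= t1; rewrite -subr_gt0 in ac.
  by apply/min_idPl; rewrite le_max ler_pdivlMr// mul1r lerD2r t1 orbT.
rewrite (_ : Num.max _ _ = 0); first by apply/min_idPr; exact: ler01.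
by apply/max_idPl; rewrite pmulr_lle0 ?invr_gt0// subr_le0.
Qed.

Section averages.
Context {R : realType} {T : Type} (h : seq bool -> T -> R).
Hypothesis h01 : forall s t, 0 <= h s t <= 1.
Implicit Types (F G : seq bool -> R) (s r : seq bool) (t : T).

(** The expectation of [F] after [n] steps of the walk started at [s] that takes the bit [true] at
    node [r] with probability [h r t]. *)
Fixpoint avg n s F t : R :=
  if n is m.+1 then
    (1 - h s t) * avg m (false :: s) F t + h s t * avg m (true :: s) F t
  else F s.

Lemma avgD m n s F t :
  avg (m + n) s F t = avg m s (fun r => avg n r F t) t.
Proof. by elim: m s => //= m IH s; rewrite !IH. Qed.

Lemma avg_linear n s a F G t :
  avg n s (fun r => a * F r + G r) t = a * avg n s F t + avg n s G t.
Proof. by elim: n s => //= n IH s; rewrite !IH; ring. Qed.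

Lemma avg_le n s F G t :
  (forall r, size r = n -> F (r ++ s) <= G (r ++ s)) ->
  avg n s F t <= avg n s G t.
Proof.
elim: n s => [|n IH] s FG /=; first exact: (FG [::]).
have /andP[h0 h1] := h01 s t; apply: lerD; apply: ler_wpM2l; rewrite ?subr_ge0//;
by apply: IH => r rn; rewrite -cat_rcons; apply: FG; rewrite size_rcons rn.
Qed.

Lemma avg_addc n s F c t : avg n s (fun r => F r + c) t = avg n s F t + c.
Proof. by elim: n s => //= n IH s; rewrite !IH; ring. Qed.

Lemma avg_cst n s c t : avg n s (fun=> c) t = c.
Proof. by elim: n s => //= n IH s; rewrite !IH; ring. Qed.

Lemma avg_near n s F G e t :
  (forall r, size r = n -> `|F (r ++ s) - G (r ++ s)| <= e) ->
  `|avg n s F t - avg n s G t| <= e.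
Proof.
move=> FG; rewrite ler_distl -!avg_addc.
by apply/andP; split; apply: avg_le => r /FG; rewrite ler_distl => /andP[].
Qed.

(** At such a point the walk from the root goes to [s] with certainty. As [s] has its most recent
    bit first, the induction splits off the last step by [avgD]. *)
Lemma avg_follows s F t : follows h s t -> avg (size s) [::] F t = F s.
Proof.
elim: s F => //= b s IH F [hb /IH avgE].
change (avg (size s).+1 [::] F t = F (b :: s)); rewrite -[(size s).+1]addn1 avgD avgE /= hb.
by case: b {hb} => /=; ring.
Qed.

End averages.

Lemma continuous_avg {R : realType} {K : topologicalType} (h : seq bool -> K -> R) n s F :
  (forall s, continuous (h s)) -> continuous (avg h n s F).
Proof.
move=> hc; elim: n s => [|n IH] s t /=; first exact: cvg_cst.
apply: cvgD; apply: cvgM; [|exact: IH|exact: hc|exact: IH].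
by apply: cvgB; [exact: cvg_cst|exact: hc].
Qed.

(** * Encoding the dual ball by branches *)

Section dual_ball.
Context {R : realType} {V : lmodType R} (p : V -> R).
Hypothesis (pN : forall x, p (- x) = p x).
Implicit Types (u v : V -> R) (x y : V) (e : R).

Definition dual_ball u : Prop := reallinear u /\ forall x, u x <= p x.

Lemma reallinearB u x y : reallinear u -> u (x - y) = u x - u y.
Proof.
by move=> ul; have := ul (-1) y x; rewrite scaleN1r addrC => ->; rewrite mulN1r addrC.
Qed.

Lemma dual_ball_le u x : dual_ball u -> `|u x| <= p x.
Proof.
move=> [ul up]; rewrite ler_norml up andbT lerNl.
have u0 : u 0 = 0 by rewrite -(subrr 0) reallinearB// subrr.
by have := up (- x); rewrite pN -sub0r reallinearB// u0 sub0r.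
Qed.
End dual_ball.

Section coding.
Context {R : realType} {V : lmodType R} (p : V -> R).
Hypothesis (pN : forall x, p (- x) = p x).
Context (y : nat -> V).
Hypothesis y_dense : forall x e, 0 < e -> exists j, p (x - y j) <= e.
Implicit Types (u v : V -> R) (x : V) (e : R) (s r : seq bool).

(* A countable family of tests deciding, up to arbitrary precision, the value of
   [u] at every [y j]; the shift by [p (y j)] makes it nonnegative on the ball. *)
Definition test n u : bool :=
  if unpickle n is Some (j, m, k) then m.+1%:R * (u (y j) + p (y j)) <= k%:R :> R
  else false.

(** If [u] exceeded [v] by more than [1 / (m + 1)] at [y j], the first integer [k] above the scaled
    and shifted value of [v] would be a threshold that [v] passes and [u] fails. As [v <= p], only
    the finitely many [k < L] occur. *)
Lemma test_le m j : exists N, forall u v, dual_ball p u -> dual_ball p v ->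
  (forall n, (n < N)%N -> test n u = test n v) ->
  u (y j) - v (y j) <= m.+1%:R^-1.
Proof.
pose L := (Num.truncn (m.+1%:R * (p (y j) + p (y j)))).+2.
exists (\max_(k < L) pickle (j, m, val k)).+1 => u v ub vb uv.
rewrite leNgt; apply/negP => lt1.
have m0 : 0 < m.+1%:R :> R by rewrite ltr0n.
have vy0 : 0 <= v (y j) + p (y j).
  by have := dual_ball_le pN (y j) vb; rewrite ler_norml => /andP[]; lra.
have vy := vb.2 (y j).
pose k := (Num.truncn (m.+1%:R * (v (y j) + p (y j)))).+1.
have ma0 : 0 <= m.+1%:R * (v (y j) + p (y j)) by rewrite mulr_ge0// ltW.
have /andP[k1 k2] := truncn_itv ma0.
have kL : (k < L)%N.
  rewrite /k /L !ltnS; apply: le_truncn; first by rewrite ler_wpM2l ?ler0n// lerD2r.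
have := uv (pickle (j, m, k)).
rewrite ltnS (@leq_bigmax _ (fun k : 'I_L => pickle (j, m, val k)) (Ordinal kL)) => /(_ isT).
rewrite /test pickleK (ltW k2).
apply/negP; rewrite -ltNge.
have : 1 < m.+1%:R * (u (y j) - v (y j)) by rewrite -ltr_pdivrMl// mulr1.
move: k1; rewrite /k -natr1; lra.
Qed.

Lemma test_near x e : 0 < e -> exists N, forall u v, dual_ball p u -> dual_ball p v ->
  (forall n, (n < N)%N -> test n u = test n v) -> `|u x - v x| <= e.
Proof.
move=> e0; have e3 : 0 < e / 3 by rewrite divr_gt0.
have [j xj] := y_dense x e3.
have [m _ mE] : exists2 m : nat, True & m.+1%:R^-1 <= e / 3.
  exists (Num.truncn (e / 3)^-1) => //.
  by rewrite -[leRHS]invrK lef_pV2 ?posrE ?invr_gt0 ?ltr0n// ltW// truncnS_gt.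
have [N NP] := test_le m j.
exists N => u v ub vb uv.
have h1 := le_trans (NP _ _ ub vb uv) mE.
have h2 := le_trans (NP _ _ vb ub (fun n nN => esym (uv n nN))) mE.
have := le_trans (dual_ball_le pN (x - y j) ub) xj.
have := le_trans (dual_ball_le pN (x - y j) vb) xj.
rewrite (reallinearB _ _ ub.1) (reallinearB _ _ vb.1).
rewrite !ler_norml => /andP[? ?] /andP[? ?]; apply/andP; split; lra.
Qed.

Fixpoint coded u s : bool :=
  if s is b :: r then (test (size r) u == b) && coded u r else true.

Lemma coded_cat u r s : coded u (r ++ s) -> coded u s.
Proof. by elim: r => //= b r IH /andP[_ /IH]. Qed.

Lemma coded_agree u v s n : coded u s -> coded v s -> (n < size s)%N ->
  test n u = test n v.
Proof.
elim: s => //= b s IH /andP[/eqP ub us] /andP[/eqP vb vs].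
rewrite ltnS leq_eqVlt => /predU1P[->|]; first by rewrite ub vb.
exact: IH.
Qed.

Lemma coded_exists u n : exists2 s, size s = n & coded u s.
Proof.
elim: n => [|n [s sn us]]; first by exists [::].
by exists (test (size s) u :: s); rewrite /= ?sn ?eqxx.
Qed.

(** A node that is the code of some functional in the ball receives such a functional. By
    [test_near], functionals sharing a long code are close at [x]; this gives both the Cauchy
    estimate down the tree and the approximation of each [u] at every deep level. *)
Lemma coding : sublinear p -> exists phi : seq bool -> V -> R,
  (forall s, dual_ball p (phi s)) /\
  forall x e, 0 < e -> exists N, 
    (forall s r, (N <= size s)%N -> `|phi (r ++ s) x - phi s x| <= e) /\
    (forall u n, dual_ball p u -> (N <= n)%N ->
      exists2 s, size s = n & `|phi s x - u x| <= e).
Proof.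
move=> ps; have [u0 [u0l u0p _]] := hahn_banach 0 ps.
have /choice[pick pickP] s : exists u, dual_ball p u /\
    ((exists2 v, dual_ball p v & coded v s) -> coded u s).
  have [[v vb vs]|ns] := pselect (exists2 v, dual_ball p v & coded v s).
    by exists v.
  by exists u0; split.
(* When no functional has code [b :: r], the functional of [r] is repeated. *)
pose phi := fix phi s := if s is b :: r then
  if `[< exists2 v, dual_ball p v & coded v s >] then pick s else phi r
  else u0.
have phib s : dual_ball p (phi s).
  by elim: s => //= b s IH; case: ifP => // _; case: (pickP (b :: s)).
(* Below a realised [s], a functional is either picked with a code extending [s] or inherited from a
   node still at or below [s]. *)
have phic s r : (exists2 v, dual_ball p v & coded v s) -> coded (phi (r ++ s)) s.
  move=> sc; elim: r => [|b r IH].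
    case: s sc => //= b s sc; case: ifPn => [_|/asboolPn//].
    by case: (pickP (b :: s)) => _; apply.
  rewrite cat_cons /=; case: ifPn => // /asboolP sc'.
  case: (pickP (b :: (r ++ s))) => _ /(_ sc').
  exact: (@coded_cat _ (b :: r)).
(* No descendant of an unrealised node is realised, so [phi] is constant there. *)
have phie s r : ~ (exists2 v, dual_ball p v & coded v s) -> phi (r ++ s) = phi s.
  move=> ns; elim: r => //= b r IH; case: ifPn => // /asboolP[v vb vs].
  by case: ns; exists v => //; exact: (@coded_cat _ (b :: r)).
exists phi; split=> // x e e0; have [N NP] := test_near x e0; exists N; split.
  move=> s r Ns; have [sc|ns] := pselect (exists2 v, dual_ball p v & coded v s).
    apply: NP => // n nN; apply: (@coded_agree _ _ s).
    - exact: phic.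
    - exact: (phic s [::]).
    - exact: leq_trans Ns.
  by rewrite phie// subrr normr0 ltW.
move=> u n ub Nn; have [s sn us] := coded_exists u n; exists s => //.
apply: NP => // k kN; apply: (@coded_agree _ _ s) => //.
- by apply: (phic s [::]); exists u.
- by rewrite sn; exact: leq_trans Nn.
Qed.

End coding.

Lemma dyadic_functionals {R : realType} {K : topologicalType}
    (h : seq bool -> K -> R) {V : lmodType R} (p : V -> R) (y : nat -> V) :
  (forall s, continuous (h s)) -> (forall s t, 0 <= h s t <= 1) ->
  (forall s, exists t, follows h s t) ->
  sublinear p -> (forall x, p (- x) = p x) ->
  (forall x e, 0 < e -> exists j, p (x - y j) <= e) ->
  exists U : V -> K -> R, [/\ forall x, continuous (U x),
    forall t, dual_ball p (U^~ t) &
    forall x e, 0 < e -> exists t, p x - e <= U x t].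
Proof.
move=> hc h01 hf ps pN yd.
have [phi [phib phiP]] := coding pN yd ps.
pose A n x t := avg h n [::] (phi^~ x) t.
(* Going from level [n] to level [m] averages over descendants of nodes at level [n]. The resulting
   [N] does not depend on [t], so the convergence is uniform. *)
have AP x e : 0 < e -> exists N, (forall n m t, (N <= n)%N -> (n <= m)%N ->
       `|A m x t - A n x t| <= e) /\
    (forall u n, dual_ball p u -> (N <= n)%N -> exists t, `|A n x t - u x| <= e).
  move=> e0; have [N [phi1 phi2]] := phiP x e e0; exists N; split.
    move=> n m t Nn nm; rewrite /A -(subnK nm) addnC avgD.
    apply: avg_near => // r rn; rewrite cats0 -(avg_cst h (m - n) r (phi r x) t).
    by apply: avg_near => // q _; apply: phi1; rewrite rn.
  move=> u n ub Nn; have [s sn su] := phi2 u n ub Nn.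
  have [t st] := hf s; exists t.
  by rewrite /A -sn avg_follows.
have Acvg x t : cvg (A n x t @[n --> \oo]).
  apply: cauchy_cvg; apply: cauchy_exP => e e0.
  have [N [AN _]] := AP x (e / 2) (divr_gt0 e0 (ltr0Sn _ _)).
  exists (A N x t); exists N => // n /= Nn; rewrite /ball/=.
  by rewrite distrC (le_lt_trans (AN _ _ _ _ Nn))// ltr_pdivrMr// ltr_pMr// ltr1n.
pose U x t : R := lim (A n x t @[n --> \oo]).
have UA x e : 0 < e -> exists N, (forall n t, (N <= n)%N -> `|U x t - A n x t| <= e) /\
    (forall u n, dual_ball p u -> (N <= n)%N -> exists t, `|A n x t - u x| <= e).
  move=> e0; have [N [A1 A2]] := AP x e e0; exists N; split=> // n t Nn.
  apply/ler_addgt0Pr => d d0.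
  have /cvgrPdist_le/(_ d d0)[M _ UM] := Acvg x t.
  have := A1 n (maxn M n) t Nn (leq_maxr _ _).
  have := UM (maxn M n) (leq_maxl _ _); rewrite -/(U x t).
  rewrite !ler_norml => /andP[? ?] /andP[? ?]; apply/andP; split; lra.
exists U; split.
- move=> x t; apply/cvgrPdist_le => e e0.
  have [N [UN _]] := UA x (e / 3) (divr_gt0 e0 (ltr0Sn _ _)).
  have /cvgrPdist_le/(_ (e / 3) (divr_gt0 e0 (ltr0Sn _ _))) :=
    @continuous_avg _ _ h N [::] (phi^~ x) hc t.
  apply: filterS => r; rewrite -/(A N x t) -/(A N x r).
  have := UN N t (leqnn _); have := UN N r (leqnn _).
  rewrite !ler_norml => /andP[? ?] /andP[? ?] /andP[? ?]; apply/andP; split; lra.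
- move=> t; split=> [a x z|x].
    apply: cvg_lim => //.
    rewrite (_ : (fun n => _) = (fun n => a * A n x t + A n z t)); last first.
      apply/funext => n; rewrite /A -avg_linear; congr avg.
      by apply/funext => s; rewrite (phib s).1.
    by apply: cvgD; [apply: cvgM; [exact: cvg_cst|exact: Acvg]|exact: Acvg].
  apply: limr_le; first exact: Acvg.
  apply: nearW => n; rewrite /A -[leRHS](avg_cst h n [::] (p x) t).
  by apply: avg_le => // r _; exact: (phib _).2.
- move=> x e e0; have [N [UN AN]] := UA x (e / 2) (divr_gt0 e0 (ltr0Sn _ _)).
  (* A functional norming [x] is approximated at level [N] by a node, and a point following that
     node realises its value. *)
  have [u [ul up ux]] := hahn_banach x ps.
  have [t tu] := AN u N (conj ul up) (leqnn N); exists t.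
  have := UN N t (leqnn N); move: tu; rewrite ux !ler_norml => /andP[? ?] /andP[? ?].
  lra.
Qed.

(** * Separated sequences of continuous functions *)

Section scalar_parts.
Context {R : realType} {s : scalar_kind}.
Local Notation F := (scalar_field R s).

(* Taken to be [0] over the reals, so that [z = Re z + i Im z] in both cases. *)
Definition imag_unit : F :=
  match s return scalar_field R s with
  | RealScalars => 0
  | ComplexScalars => complex.Complex 0 1
  end.

Definition real_part : F -> R :=
  match s return scalar_field R s -> R with
  | RealScalars => id
  | ComplexScalars => @complex.Re R
  end.

Definition imag_part : F -> R :=
  match s return scalar_field R s -> R with
  | RealScalars => fun=> 0
  | ComplexScalars => @complex.Im R
  end.

Lemma scalarE (z : F) : z = of_real (real_part z) + imag_unit * of_real (imag_part z).
Proof.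
rewrite /imag_unit /real_part /imag_part /of_real; case: s z => /= z; first by rewrite mul0r addr0.
by case: z => a b; congr (complex.Complex _ _) => /=; ring.
Qed.

Lemma modulus_imag_unit : modulus (imag_unit : F) <= 1.
Proof.
rewrite /imag_unit /modulus; case: s => /=; first by rewrite normr0.
by rewrite expr0n/= expr1n add0r sqrtr1.
Qed.

Lemma real_part_le (z : F) : `|real_part z| <= modulus z.
Proof.
rewrite /real_part /modulus; case: s z => //= -[a b] /=.
by rewrite -sqrtr_sqr ler_wsqrtr// lerDl sqr_ge0.
Qed.

Lemma imag_part_le (z : F) : `|imag_part z| <= modulus z.
Proof.
rewrite /imag_part /modulus; case: s z => [z|[a b]] /=; first by rewrite normr0.
by rewrite -sqrtr_sqr ler_wsqrtr// lerDr sqr_ge0.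
Qed.

Lemma real_partB (z w : F) : real_part (z - w) = real_part z - real_part w.
Proof. by rewrite /real_part; case: s z w => //= -[a b] [c d]. Qed.

Lemma imag_partB (z w : F) : imag_part (z - w) = imag_part z - imag_part w.
Proof. by rewrite /imag_part; case: s z w => //= [_ _|[a b] [c d]//]; rewrite subr0. Qed.

Lemma of_realE (a : R) : modulus (of_real a : F) = `|a|.
Proof.
rewrite /modulus /of_real; case: s => //=.
by rewrite expr0n addr0 sqrtr_sqr.
Qed.

Lemma modulus_parts_lt (z : F) (e : R) :
  `|real_part z| < e / 2 -> `|imag_part z| < e / 2 -> modulus z < e.
Proof.
move=> re im; rewrite [z]scalarE (le_lt_trans (ler_modulusD _ _))//.
rewrite modulusM !of_realE.
have := ler_wpM2r (normr_ge0 (imag_part z)) modulus_imag_unit.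
lra.
Qed.

End scalar_parts.

(** Among [N * N + 1] consecutive terms from index [L] on, two share one of [N * N] square cells of
    side [d]. The free [L] lets later pairs avoid earlier ones. *)
Lemma pigeonhole_grid {R : realType} (x : nat -> R * R) (M d : R) (L : nat) :
  0 < d -> (forall n, `|(x n).1| <= M /\ `|(x n).2| <= M) ->
  exists a b, [/\ (L <= a)%N, (L <= b)%N, a != b,
    `|(x a).1 - (x b).1| < d & `|(x a).2 - (x b).2| < d].
Proof.
move=> d0 xM.
pose cell (r : R) := Num.truncn ((r + M) / d).
pose N := (Num.truncn ((M + M) / d)).+1.
have cellN r : `|r| <= M -> (cell r < N)%N.
  rewrite ler_norml => /andP[_ rM]; rewrite ltnS; apply: le_truncn.
  by rewrite ler_pM2r ?invr_gt0// lerD2r.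
have cell_near r r' : `|r| <= M -> `|r'| <= M -> cell r = cell r' -> `|r - r'| < d.
  have H q : `|q| <= M -> (cell q)%:R * d <= q + M < (cell q)%:R * d + d.
    rewrite ler_norml => /andP[Mq _].
    have q0 : 0 <= (q + M) / d by rewrite divr_ge0 ?(ltW d0)//; lra.
    have := truncn_itv q0; rewrite ler_pdivlMr// ltr_pdivrMr//.
    by rewrite -/(cell q) => /andP[-> /=]; rewrite -natr1 mulrDl mul1r.
  move=> /H /andP[h1 h2] /H /andP[h3 h4] rr'; rewrite rr' in h1 h2.
  by rewrite ltr_norml; apply/andP; split; lra.
pose f (n : 'I_(N * N).+1) : 'I_N * 'I_N :=
  (Ordinal (cellN _ (xM (L + n)%N).1), Ordinal (cellN _ (xM (L + n)%N).2)).
have : ~~ injectiveb f.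
  apply/negP => /injectiveP/leq_card; rewrite card_prod !card_ord ltnn//.
move=> /injectivePn[i [j ij /eqP]]; rewrite xpair_eqE -!val_eqE/= => /andP[/eqP f1 /eqP f2].
exists (L + i)%N, (L + j)%N; split; rewrite ?leq_addr ?eqn_add2l//.
- by apply: cell_near => //; [exact: (xM _).1|exact: (xM _).1].
- by apply: cell_near => //; [exact: (xM _).2|exact: (xM _).2].
Qed.

Section separated.
Context {R : realType} {s : scalar_kind} {K : topologicalType}.
Local Notation F := (scalar_field R s).

Definition separated (d : R) (phi : nat -> K -> F) : Prop :=
  forall A B : seq nat, A != [::] -> B != [::] -> ~~ has (mem A) B ->
    exists t, forall a b, a \in A -> b \in B -> d <= modulus (phi a t - phi b t).

(* Working with the real functions [gap phi] instead of [phi] makes the largeness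
   argument insensitive to the scalar field. *)
Definition gap (phi : nat -> K -> F) (x : nat * nat) (t : K) : R :=
  modulus (phi x.1 t - phi x.2 t).

Lemma continuous_gap phi x : (forall n, continuous (phi n)) -> continuous (gap phi x).
Proof.
move=> phic t; apply: (@continuous_comp _ _ _ (fun t => phi x.1 t - phi x.2 t) modulus).
  by apply: cvgB; exact: phic.
exact: continuous_modulus.
Qed.

Lemma close_pair (phi : nat -> K -> F) M d t L : 0 < d ->
  (forall n t, modulus (phi n t) <= M) ->
  exists x : nat * nat, [/\ (L <= x.1)%N, (L <= x.2)%N, x.1 != x.2 & gap phi x t < d].
Proof.
move=> d0 phiM.
have d2 : 0 < d / 2 by rewrite divr_gt0.
have [n|a [b [La Lb ab re im]]] := @pigeonhole_grid R
    (fun n => (real_part (phi n t), imag_part (phi n t))) M (d / 2) L d2.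
  by split; [exact: le_trans (real_part_le _) _|exact: le_trans (imag_part_le _) _].
exists (a, b); split=> //; apply: modulus_parts_lt.
  by rewrite real_partB.
by rewrite imag_partB.
Qed.

(* If the gaps took countably many values, one could choose disjoint pairs
   [(a_k, b_k)] such that every point has a pair with a small gap; by
   compactness finitely many pairs would do, contradicting separation. *)
Lemma separated_large (phi : nat -> K -> F) M d : compact [set: K] ->
  (forall n, continuous (phi n)) -> (forall n t, modulus (phi n t) <= M) ->
  0 < d -> separated d phi -> large (gap phi) [set: K].
Proof.
move=> cK phic phiM d0 sep cnt.
have [t0 _] := sep [:: 0%N] [:: 1%N] isT isT isT.
have [f finj] := countable_injP _ cnt.
(* [f] numbers the countably many gap families, and [z k] represents all points whose family has
   number [k]. *)
have /choice[z zP] k : exists z, forall t, f ((gap phi)^~ t) = k ->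
    (gap phi)^~ z = (gap phi)^~ t.
  have [[z zk]|nz] := pselect (exists z, f ((gap phi)^~ z) = k).
    exists z => t tk; apply: finj; rewrite ?inE; [by exists z|by exists t|].
    by rewrite zk tk.
  by exists t0 => t tk; case: nz; exists t.
have /choice[pair pairP] kL : exists x : nat * nat,
    [/\ (kL.2 <= x.1)%N, (kL.2 <= x.2)%N, x.1 != x.2 & gap phi x (z kL.1) < d].
  exact: close_pair phiM.
(* [bnd k] exceeds every index used in the earlier pairs, so that distinct pairs share no index. *)
pose bnd := fix bnd k := if k is l.+1 then
  (maxn (pair (l, bnd l)).1 (pair (l, bnd l)).2).+1 else 0%N.
pose x k := pair (k, bnd k).
have bnd_mono k l : (k < l)%N -> ((x k).1 < bnd l)%N /\ ((x k).2 < bnd l)%N.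
  elim: l => // l IH; rewrite ltnS leq_eqVlt => /predU1P[->|/IH[k1 k2]] /=.
    by rewrite !ltnS leq_maxl leq_maxr.
  have [] := pairP (l, bnd l) => /= l1 _ _ _.
  by split; rewrite ltnS leq_max (leq_trans _ l1) ?(ltnW k1) ?(ltnW k2).
have x_disj k l : (x k).1 != (x l).2.
  have [kl|lk|->] := ltngtP k l.
  - have [k1 _] := bnd_mono _ _ kl; have [_ l2 _ _] := pairP (l, bnd l).
    by rewrite neq_ltn (leq_trans k1 l2).
  - have [_ l2] := bnd_mono _ _ lk; have [k1 _ _ _] := pairP (k, bnd k).
    by rewrite neq_ltn (leq_trans l2 k1) orbT.
  - by have [] := pairP (l, bnd l).
pose U k := [set t | gap phi (x k) t < d].
have Uo k : open (U k).
  have -> : U k = gap phi (x k) @^-1` [set r | r < d] by [].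
  apply: open_comp; last exact: open_lt.
  by move=> t _; exact: continuous_gap.
have inU t : exists k, U k t.
  exists (f ((gap phi)^~ t)); rewrite /U /=.
  have [_ _ _] := pairP (f ((gap phi)^~ t), bnd (f ((gap phi)^~ t))).
  by rewrite -(congr1 (@^~ (x (f ((gap phi)^~ t)))) (zP _ t erefl)).
(* The unions of the first [N] sets [U k] are open, increase with [N] and exhaust [K], so
   near-covering along [\oo] yields one [N] for all points. *)
have /compact_near_coveringP/(_ nat \oo (fun N t => exists2 k, (k < N)%N & U k t)) := cK.
case=> [t _|N _ cov].
  have [k Ukt] := inU t; exists (U k, [set N | (k < N)%N]) => /=.
    by split; [exact: open_nbhs_nbhs|exists k.+1].
  by move=> [t' N] [/= Ut' kN]; exists k.
have {}cov t : exists2 k, k \in iota 0 N & U k t.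
  by have [k kN Ukt] := cov N (leqnn N) t I; exists k => //; rewrite mem_iota.
have [t t_lt] : exists t, forall k, k \in iota 0 N -> d <= gap phi (x k) t.
  (* A cover of [t0] shows that the two lists of indices are nonempty, as separation requires. *)
  have [k kN _] := cov t0.
  have [| | |t tP] := sep [seq (x k).1 | k <- iota 0 N] [seq (x k).2 | k <- iota 0 N].
  - by case: (iota 0 N) kN.
  - by case: (iota 0 N) kN.
  - apply/hasPn => _ /mapP[l _ ->]; apply/negP => /mapP[m _ /eqP].
    by rewrite eq_sym (negbTE (x_disj _ _)).
  by exists t => l lN; apply: tP; exact: map_f.
have [k kN] := cov t.
by rewrite /U /= ltNge => /negP; apply; exact: t_lt.
Qed.

End separated.

(** * Low distortion embeddings of the graph *)

Section embedding.
Context {R : realType} {s : scalar_kind} {K : topologicalType}.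
Context (cK : compact [set: K]).
Local Notation CK := (contfun R s cK).
Context (f : vertex -> CK) (C1 C2 : R).
Hypothesis fC : bilipschitz_consts (fun x y : vertex => (path_dist x y)%:R)
  (@norm_dist R s CK) f C1 C2.

Lemma norm_dist_sup_norm (u v : CK) : norm_dist u v = sup_norm (u - v).
Proof. by rewrite /norm_dist contfun_normE of_realK// sup_norm_ge0. Qed.

Lemma embedding_le x y t : modulus (f x t - f y t) <= C2 * (path_dist x y)%:R.
Proof.
have [_ _ /(_ x y)/andP[_]] := fC; apply: le_trans.
by rewrite norm_dist_sup_norm (sup_norm_ub (f x - f y)).
Qed.

(** Otherwise [e] bounds the supremum norm; [0 <= e] ensures this also for empty [K], where the norm
    is 0. *)
Lemma embedding_separates x y e : 0 <= e -> e < C1 * (path_dist x y)%:R ->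
  exists t, e < modulus (f x t - f y t).
Proof.
move=> e0 exy; apply: contrapT => nt.
have [_ _ /(_ x y)/andP[+ _]] := fC.
rewrite norm_dist_sup_norm leNgt => /negP; apply.
apply: le_lt_trans exy; apply: sup_norm_le => // t.
by rewrite leNgt; apply/negP => et; apply: nt; exists t.
Qed.

Definition point (n : nat) : posnat := exist _ n.+1 isT.

Lemma point_inj : injective point.
Proof. by move=> n m []. Qed.

Definition point_fset (A : seq nat) : {fset posnat} := seq_fset tt (map point A).

Lemma mem_point_fset n A : (point n \in point_fset A) = (n \in A).
Proof. by rewrite seq_fsetE mem_map//; exact: point_inj. Qed.

Lemma point_fset_neq0 A : A != [::] -> point_fset A != fset0.
Proof.
case: A => // n A _; apply/fset0Pn; exists (point n).
by rewrite mem_point_fset mem_head.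
Qed.

Lemma embedding_separated : C2 < 2 * C1 ->
  separated (2 * C1 - C2) (fun n t => f (Pt (point n)) t).
Proof.
move=> C12 A B A0 B0 AB.
pose FA : finsub := exist (fun A : {fset posnat} => is_true (A != fset0)) _ (point_fset_neq0 A0).
pose FB : finsub := exist (fun A : {fset posnat} => is_true (A != fset0)) _ (point_fset_neq0 B0).
have AB0 : (val FA `&` val FB)%fset = fset0.
  apply/fsetP => x; rewrite in_fset0 in_fsetI /= !seq_fsetE.
  apply/negP => /andP[/mapP[n nA ->]]; rewrite mem_map; last exact: point_inj.
  by move=> nB; move/hasP: AB; apply; exists n.
have FAB : FA != FB.
  apply/eqP => FAB; move: AB0; rewrite FAB fsetIid => /eqP.
  by apply/negP; exact: (valP FB).
have [C10 C20 _] := fC.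
(* The value [2 * C1 + C2] is midway between [2 * C2] and [4 * C1]. Passing from each finite set to
   one of its points costs at most [C2], which leaves [2 * C1 - C2]. *)
have [||t tAB] := @embedding_separates (Fin FA) (Fin FB) (2 * C1 + C2).
- by rewrite addr_ge0 ?mulr_ge0 ?ltW.
- by rewrite path_dist_fin_fin// AB0 eqxx/=; lra.
exists t => a b aA bB.
have := embedding_le (Fin FA) (Pt (point a)) t.
have := embedding_le (Pt (point b)) (Fin FB) t.
rewrite (path_dist_sym (Fin FA)) !path_dist_pt_fin /= !mem_point_fset aA bB !mulr1.
rewrite (_ : f (Fin FA) t - f (Fin FB) t = (f (Fin FA) t - f (Pt (point a)) t) +
  (f (Pt (point a)) t - f (Pt (point b)) t) +
  (f (Pt (point b)) t - f (Fin FB) t)) in tAB; last by ring.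
have := ler_modulusD (f (Fin FA) t - f (Pt (point a)) t +
  (f (Pt (point a)) t - f (Pt (point b)) t)) (f (Pt (point b)) t - f (Fin FB) t).
have := ler_modulusD (f (Fin FA) t - f (Pt (point a)) t)
  (f (Pt (point a)) t - f (Pt (point b)) t).
lra.
Qed.

Lemma embedding_bounded : exists M, forall n t, modulus (f (Pt (point n)) t) <= M.
Proof.
exists (C2 + sup_norm (f Root)) => n t.
rewrite -[f (Pt _) t](subrK (f Root t)) (le_trans (ler_modulusD _ _))//.
rewrite lerD ?sup_norm_ub// (le_trans (embedding_le _ _ _))//.
by rewrite path_dist_sym path_dist_root_pt mulr1.
Qed.

End embedding.

Lemma low_distortion_dyadic (R : realType) (s : scalar_kind)
    (K : topologicalType) (cK : compact [set: K]) (D : R) : D < 2 ->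
  embeds_with_distortion (fun x y : vertex => (path_dist x y)%:R)
       (@norm_dist R s (contfun R s cK)) D ->
  exists h : seq bool -> K -> R, [/\ forall s, continuous (h s),
    forall s t, 0 <= h s t <= 1 & forall s, exists t, follows h s t].
Proof.
move=> D2 [f [[C1 [C2 fC]] fD]].
have rne : [set r | exists c1 c2, bilipschitz_consts
    (fun x y : vertex => (path_dist x y)%:R : R) (@norm_dist R s _) f c1 c2 /\
    r = c2 / c1] !=set0 by exists (C2 / C1), C1, C2.
(* The distortion is an infimum; being below 2, it yields actual constants with ratio below 2. *)
rewrite -fD in D2; have [_ [c1 [c2 [fc ->]]] c12] := inf_lt rne D2.
have [c10 c20 _] := fc; rewrite ltr_pdivrMr// in c12.
have [M phiM] := embedding_bounded fc.
apply: (@large_dyadic _ _ _ (gap (fun n t => f (Pt (point n)) t))).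
  by move=> x; apply: continuous_gap => n; exact: cts_fun.
apply: (separated_large cK _ phiM _ (embedding_separated fc c12)).
  by move=> n; exact: cts_fun.
by rewrite subr_gt0.
Qed.

(** * Isometric embedding of separable spaces *)

Section realification.
Context {R : realType} {s : scalar_kind}.
Local Notation F := (scalar_field R s).

Lemma of_real1 : of_real 1 = 1 :> F.
Proof. by rewrite /of_real; case: s. Qed.

(** An alias that carries the structure over [R], where Hahn-Banach and the dual ball are
    available. *)
Definition realified (E : lmodType F) : Type := E.

Section instances.
Variable E : lmodType F.
Implicit Types (x y : realified E) (a b : R).

HB.instance Definition _ := GRing.Zmodule.on (realified E).

Definition real_scale a x : realified E := (of_real a : F) *: (x : E).

Let real_scaleA a b x : real_scale a (real_scale b x) = real_scale (a * b) x.
Proof. by rewrite /real_scale scalerA of_realM. Qed.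

Let real_scale1 : left_id 1 real_scale.
Proof. by move=> x; rewrite /real_scale of_real1 scale1r. Qed.

Let real_scaleDr : right_distributive real_scale +%R.
Proof. by move=> a x y; rewrite /real_scale scalerDr. Qed.

Let real_scaleDl x : {morph real_scale^~ x : a b / a + b}.
Proof. by move=> a b; rewrite /real_scale of_realD scalerDl. Qed.

HB.instance Definition _ := GRing.Zmodule_isLmodule.Build R (realified E)
  real_scaleA real_scale1 real_scaleDr real_scaleDl.

End instances.
End realification.

Section real_norm.
Context {R : realType} {s : scalar_kind} {E : normedModType (scalar_field R s)}.
Local Notation F := (scalar_field R s).

Definition rnorm (x : realified E) : R := modulus (`|x : E| : F).

Lemma of_real_rnorm x : of_real (rnorm x) = `|x : E| :> F.
Proof. by rewrite of_real_modulus normr_id. Qed.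

Lemma rnormZ (z : F) (x : E) : rnorm (z *: x) = modulus z * rnorm x.
Proof. by apply: (@of_real_inj R s); rewrite of_realM !of_real_rnorm of_real_modulus normrZ. Qed.

Lemma rnormN x : rnorm (- x) = rnorm x.
Proof. by rewrite /rnorm normrN. Qed.

Lemma rnorm_sublinear : sublinear rnorm.
Proof.
split=> [x y|a x a0].
  by rewrite -(@ler_of_real R s) of_realD !of_real_rnorm ler_normD.
by rewrite [leLHS]rnormZ of_realK.
Qed.

Lemma separable_sequence : separable E ->
  exists y : nat -> realified E, forall x e, 0 < e -> exists j, rnorm (x - y j) <= e.
Proof.
move=> [S [/countable_injP[f finj] dS]].
(* Inverting [f] turns [S] into a sequence; numbers that code no point of [S] get 0. *)
have /choice[y yP] k : exists y : E, forall z, S z -> f z = k -> y = z.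
  have [[y Sy yk]|ny] := pselect (exists2 y, S y & f y = k).
    by exists y => z Sz zk; apply: finj; rewrite ?inE// yk zk.
  by exists 0 => z Sz zk; case: ny; exists z.
exists y => x e e0.
have E0 : 0 < (of_real e : F).
  by rewrite lt_def -{1 2}of_real0 ler_of_real ltW// andbT (inj_eq of_real_inj) gt_eqF.
have [|z [/= xz Sz]] := dS (ball (x : E) (of_real e : F)) _ (ball_open _ _).
  by exists (x : E); exact: ballxx.
exists (f z); rewrite (yP _ z)//.
rewrite -(@ler_of_real R s) of_real_rnorm ltW//.
by move: xz; rewrite -ball_normE.
Qed.

End real_norm.

Section complexify.
Context {R : realType} {s : scalar_kind}.
Local Notation F := (scalar_field R s).
Local Notation j := (imag_unit : F).

Lemma imag_unit_cases : j = 0 \/ j * j = -1.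
Proof.
rewrite /imag_unit; case: s => /=; first by left.
by right; congr (complex.Complex _ _) => /=; ring.
Qed.

Lemma real_partE (a b : R) : real_part (of_real a - j * of_real b : F) = a.
Proof. by rewrite /imag_unit /real_part /of_real; case: s => /=; ring. Qed.

(** The scalar is the modulus of [z] divided by [z], or 0 if [z = 0]. It reduces bounds on moduli to
    bounds on real parts. *)
Lemma rotation (z : F) : exists l : F, modulus l <= 1 /\ real_part (l * z) = modulus z.
Proof.
have re (a : R) : real_part (of_real a : F) = a.
  by rewrite -[RHS](real_partE a 0) of_real0 mulr0 subr0.
have [->|z0] := eqVneq z 0.
  by exists 0; rewrite mulr0 modulus0 -of_real0 re ler01.
have n0 : modulus z != 0 by apply: contra_neq z0; exact: modulus_eq0.
exists (of_real (modulus z) * z^-1); rewrite mulfVK// re; split=> //.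
rewrite -(@ler_pM2r _ (modulus z)) ?lt_def ?n0 ?modulus_ge0//.
by rewrite -modulusM mulfVK// mul1r of_realK// modulus_ge0.
Qed.

Lemma ltr_of_real (a b : R) : ((of_real a : F) < of_real b) = (a < b).
Proof. by rewrite !lt_def (inj_eq of_real_inj) ler_of_real. Qed.

Lemma of_realB (a b : R) : of_real (a - b) = of_real a - of_real b :> F.
Proof. by apply/eqP; rewrite -subr_eq opprK -of_realD subrK. Qed.

Lemma continuous_of_real : continuous (of_real : R -> F).
Proof.
move=> a; have FF : Filter (nbhs a) by exact: nbhs_filter.
apply/(@cvgrPdist_lt _ _ _ _ FF) => e e0.
have eE : e = of_real (modulus e) by rewrite of_real_modulus gtr0_norm.
rewrite eE -of_real0 ltr_of_real in e0.
have /cvgrPdist_lt/(_ _ e0) := @cvg_id _ (nbhs a).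
apply: filterS => b ab.
by rewrite -of_realB eE -of_real_modulus ltr_of_real of_realE.
Qed.

End complexify.

Lemma dyadic_universal (R : realType) (s : scalar_kind) (K : topologicalType)
    (cK : compact [set: K]) (h : seq bool -> K -> R) :
  (forall r, continuous (h r)) -> (forall r t, 0 <= h r t <= 1) ->
  (forall r, exists t, follows h r t) ->
  isometrically_universal (contfun R s cK).
Proof.
move=> hc h01 hf E /separable_sequence[y yd].
have [U [Uc Ub Un]] := dyadic_functionals hc h01 hf rnorm_sublinear rnormN yd.
pose F := scalar_field R s.
pose j : F := imag_unit.
have Ulin t (a : R) (x z : E) : U (of_real a *: x + z) t = a * U x t + U z t.
  exact: (Ub t).1.
(* Over the reals [j] is 0 and this is [U x t]. *)
pose T0 (x : E) (t : K) : F := of_real (U x t) - j * of_real (U (j *: x) t).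
have T0c x : continuous (T0 x).
  move=> t; apply: cvgB; last apply: cvgM; first 2 last.
    apply: continuous_comp; [exact: Uc|exact: continuous_of_real].
    apply: continuous_comp; [exact: Uc|exact: continuous_of_real].
    exact: cvg_cst.
pose T (x : E) : contfun R s cK := mkcts (T0c x).
have T0lin z x w t : T0 (z *: x + w) t = z * T0 x t + T0 w t.
  rewrite [z]scalarE -/j; set a := real_part z; set b := imag_part z.
  rewrite /T0 scalerDr !scalerDl -!addrA scalerDr (mulrC j (of_real b)) !scalerA.
  rewrite mulrCA (mulrC j (of_real a)) -!scalerA
    -[_ + _ + j *: w]addrA !Ulin.
  rewrite !of_realD !of_realM.
  have U0 : U 0 t = 0 by rewrite -(subrr (0 : realified E)) (reallinearB _ _ (Ub t).1) subrr.
  (* This stands in for [j * j = -1] over both fields: if [j = 0], both sides vanish because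
     [U 0 t = 0]. *)
  have jjV : j * j * of_real (U (j *: x) t) = - of_real (U (j *: x) t).
    have [j0|jj] := @imag_unit_cases R s; last by rewrite [j * j]jj mulN1r.
    by rewrite /j j0 scale0r U0 !mul0r of_real0 oppr0.
  have jW : j * of_real (U (j *: (j *: x)) t) = - (j * of_real (U x t)).
    have [j0|jj] := @imag_unit_cases R s; first by rewrite /j j0 !mul0r oppr0.
    rewrite scalerA [j * j]jj -mulrN; congr (_ * _).
    rewrite scaleN1r -sub0r (@reallinearB _ (realified E) (U^~ t)); last exact: (Ub t).1.
    by rewrite U0 sub0r -[- U x t]add0r of_realB of_real0 sub0r.
  apply/eqP; rewrite -subr_eq0; apply/eqP.
  transitivity ((of_real b : F) * (of_real (U (j *: x) t) + j * j * of_real (U (j *: x) t))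
    - of_real b * (j * of_real (U (j *: (j *: x)) t) + j * of_real (U x t))); first by ring.
  by rewrite jjV jW addrN addNr !mulr0 subr0.
have T00 t : T0 0 t = 0.
  apply: (addrI (T0 0 t)); rewrite addr0 -{1}[T0 0 t]mul1r -T0lin.
  by rewrite scale1r addr0.
have Tlin : linear T by move=> z x w; apply/continuousEP => t; exact: T0lin.
pose TL : {linear E -> contfun R s cK} := HB.pack T (GRing.isLinear.Build _ _ _ _ T Tlin).
exists TL => x; rewrite contfun_normE -(of_real_rnorm x); congr of_real.
apply: le_anti; apply/andP; split.
  apply: sup_norm_le => [|t]; first by exact: modulus_ge0.
  (* By linearity the rotation moves into the argument, so the modulus is the value of [U] at
     [l *: x], whose norm is at most that of [x]. *)
  have [l [l1 lT]] := rotation (T0 x t).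
  change (modulus (T0 x t) <= rnorm x).
  have -> : modulus (T0 x t) = U (l *: x) t.
    rewrite -lT -[RHS](@real_partE R s _ (U (j *: (l *: x)) t)); congr real_part.
    by rewrite -[RHS]/(T0 (l *: x) t) -[l *: x]addr0 T0lin T00 addr0.
  rewrite (le_trans ((Ub t).2 _))// rnormZ ler_piMl//.
  exact: modulus_ge0.
(* The real part of [T0 x t] is [U x t], which at this [t] comes within [e] of the norm of [x]. *)
apply/ler_addgt0Pr => e e0; have [t] := Un x e e0.
rewrite lerBlDr => /le_trans; apply; rewrite lerD2r.
have := real_part_le (T0 x t); rewrite /T0 real_partE => /(le_trans (ler_norm _)).
by move=> /le_trans; apply; exact: (sup_norm_ub (T x)).
Qed.

Unset Implicit Arguments.

Theorem corollary3 (R : realType) (s : scalar_kind)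
    (K : topologicalType) (cK : compact [set: K]) (hK : hausdorff_space K) :
  (exists D : R, D < 2 /\
     embeds_with_distortion (fun x y : vertex => (path_dist x y)%:R)
       (@norm_dist R s (contfun R s cK)) D) ->
  isometrically_universal (contfun R s cK).
Proof.
move=> [D [D2 fD]].
have [h [hc h01 hf]] := low_distortion_dyadic D2 fD.
exact: dyadic_universal hc h01 hf.
Qed.
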